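(* Let $\mathcal{F}$ be a convex set of probability distribution functions on $\mathbb{R}$, let $S: \mathcal{F} \times \mathbb{R} \to \mathbb{R}$ be a proper scoring rule and let $G \in \mathcal{F}$. Then the following are true. (a) If there is an $F \in \mathcal{F}$ with heavier tail than $G$, then for all $\varepsilon > 0$ there is an $F_\varepsilon \in \mathcal{F}$ that is not tail equivalent to $G$ and such that $$| \bar S(F_\varepsilon, G) - \bar S(G,G) | \le \varepsilon .$$ (b) Let $T: \mathcal{F} \to \mathbb{R}$ be a max-functional. If there is an $F \in \mathcal{F}$ with $T(F) > T(G)$, then for all $\varepsilon > 0$ there is an $F_\varepsilon \in \mathcal{F}$ such that $T(F_\varepsilon) = T(F) > T(G)$, while $$| \bar S(F_\varepsilon, G) - \bar S(G,G) | \le \varepsilon .$$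
   Context: Scoring rule: a map $S: \mathcal{F} \times \mathbb{R} \to \mathbb{R}$ such that for every $F \in \mathcal{F}$ the function $y \mapsto S(F,y)$ is measurable and integrable with respect to every $H \in \mathcal{F}$; write $\bar S(F,H) := \int_{\mathbb{R}} S(F,y)\, dH(y)$. It is proper if $\bar S(F,F) \le \bar S(H,F)$ for all $F, H \in \mathcal{F}$. Max-functional: a map $T: \mathcal{F} \to \mathbb{R}$ with $T(\lambda F_1 + (1-\lambda) F_0) = \max(T(F_0), T(F_1))$ for all $F_0, F_1 \in \mathcal{F}$ and $\lambda \in (0,1)$. Tails: for a distribution function $F$ on $\mathbb{R}$ let $\overline{F} := 1 - F$ and let $x^F := \sup\{ x \in \mathbb{R} \mid F(x) < 1 \} \in \mathbb{R} \cup \{\infty\}$ be its upper endpoint. A distribution function $G$ has heavier tail than $F$, written $F <_t G$, if either $x^F < x^G$, or $x^F = x^G = x^*$ and $\lim_{x \to x^*} \overline{F}(x)/\overline{G}(x) = 0$. The distribution functions $F$ and $G$ are tail equivalent if $x^F = x^G = x^* \in \mathbb{R} \cup \{\infty\}$ and $\lim_{x \to x^*} \overline{F}(x)/\overline{G}(x) \in (0,\infty)$ (in particular the limit exists). Limits $x \to x^*$ are taken over $x < x^*$. *)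

(* Defs.v *)
From HB Require Import structures.
From mathcomp Require Import all_boot all_order all_algebra.
From mathcomp Require Import all_classical all_reals all_analysis.
Set Implicit Arguments.
Unset Strict Implicit.
Unset Printing Implicit Defensive.
Import Order.TTheory GRing.Theory Num.Theory numFieldNormedType.Exports.
Local Open Scope classical_set_scope.
Local Open Scope ring_scope.

(* Nondecreasing right-continuous functions R -> R with limits 0 at -oo and
   1 at +oo.  Integration with respect to [F] is integration with respect to
   [lebesgue_stieltjes_measure F], the probability measure whose distribution
   function is [F] (cf. [cdf_lebesgue_stieltjes_id]). *)
Notation distribution_function R := (cumulativeBounded (0 : R) (1 : R)).

Definition mixture_fun (R : realType) (l : {i01 R}) (F1 F0 : R -> R) (x : R)
  : R := l%:num * F1 x + (1 - l%:num) * F0 x.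

Section mixture.
Context {R : realType} (l : {i01 R}) (F1 F0 : distribution_function R).

Lemma mixture_nd : nondecreasing (mixture_fun l F1 F0).
Proof.
move=> x y xy; rewrite /mixture_fun lerD// ler_wpM2l ?subr_ge0//;
  exact: cumulative_is_nondecreasing.
Qed.

Lemma mixture_rc : right_continuous (mixture_fun l F1 F0).
Proof.
by move=> x; apply: cvgD; apply: cvgM (cvg_cst _) _; apply: cumulative_is_right_continuous.
Qed.

HB.instance Definition _ := isCumulative.Build R _ R
  (mixture_fun l F1 F0) mixture_nd mixture_rc.

Lemma mixtureNy : mixture_fun l F1 F0 @ -oo --> (0 : R).
Proof.
rewrite -[X in _ --> X](_ : l%:num * 0 + (1 - l%:num) * 0 = 0).
  by apply: cvgD; apply: cvgM (cvg_cst _) _; apply: cumulativeNy.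
by rewrite !mulr0 addr0.
Qed.

Lemma mixturey : mixture_fun l F1 F0 @ +oo --> (1 : R).
Proof.
rewrite -[X in _ --> X](_ : l%:num * 1 + (1 - l%:num) * 1 = 1).
  by apply: cvgD; apply: cvgM (cvg_cst _) _; apply: cumulativey.
by rewrite !mulr1 subrKC.
Qed.

HB.instance Definition _ := isCumulativeBounded.Build R 0 1
  (mixture_fun l F1 F0) mixtureNy mixturey.

Definition mixture : distribution_function R := mixture_fun l F1 F0.

End mixture.

Section scoring.
Context {R : realType}.
Implicit Types (FF : set (distribution_function R))
  (F G H : distribution_function R).

Definition convex_family FF :=
  forall (l : {i01 R}) F1 F0, FF F1 -> FF F0 -> FF (mixture l F1 F0).

(* A function on [FF] is encoded as a total function on distribution functions
   of which only the values on [FF] are constrained or used. *)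
Definition scoring_rule FF (S : distribution_function R -> R -> R) :=
  forall F, FF F ->
    measurable_fun [set: R] (S F) /\
    forall H, FF H ->
      (lebesgue_stieltjes_measure H).-integrable [set: R] (EFin \o S F).

Definition expected_score (S : distribution_function R -> R -> R) F H : R :=
  \int[lebesgue_stieltjes_measure H]_y S F y.

Definition proper_scoring_rule FF (S : distribution_function R -> R -> R) :=
  scoring_rule FF S /\
  forall F H, FF F -> FF H -> expected_score S F F <= expected_score S H F.

Definition max_functional FF (T : distribution_function R -> R) :=
  forall F0 F1, FF F0 -> FF F1 -> forall l : {i01 R}, 0 < l%:num < 1 ->
    T (mixture l F1 F0) = Num.max (T F0) (T F1).

Definition tail F (x : R) : R := 1 - F x.

Definition upper_endpoint F : \bar R :=
  ereal_sup [set x%:E | x in [set x | F x < 1]].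

(* The filter of [x --> xs] over real [x < xs]; the value at [-oo] is
   immaterial since an upper endpoint is never [-oo]. *)
Definition left_filter (xs : \bar R) : set_system R :=
  match xs with
  | r%:E => r^'-
  | +oo%E => +oo
  | -oo%E => -oo
  end.

Global Instance left_filter_proper (xs : \bar R) :
  ProperFilter (left_filter xs).
Proof. by case: xs => [r| |] /=; apply: _. Qed.

(* [F <_t G]: [G] has heavier tail than [F] *)
Definition heavier_tail G F :=
  (upper_endpoint F < upper_endpoint G)%E \/
  upper_endpoint F = upper_endpoint G /\
  tail F x / tail G x @[x --> left_filter (upper_endpoint G)] --> (0 : R).

Definition tail_equivalent F G :=
  upper_endpoint F = upper_endpoint G /\
  exists2 c : R, 0 < c &
    tail F x / tail G x @[x --> left_filter (upper_endpoint G)] --> c.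

End scoring.

(* Main.v *)
Require Import Defs.
From HB Require Import structures.
From mathcomp Require Import all_boot all_order all_algebra.
From mathcomp Require Import all_classical all_reals all_analysis.
From mathcomp Require Import measurable_realfun ring lra.
Set Implicit Arguments.
Unset Strict Implicit.
Unset Printing Implicit Defensive.
Import Order.TTheory GRing.Theory Num.Theory numFieldNormedType.Exports.
Local Open Scope classical_set_scope.
Local Open Scope ring_scope.

(** The witness in both parts is a mixture M = l F + (1 - l) G with small l > 0,
F being the distribution function that the hypothesis provides.  Write S(A, B)
for the expected score of A under B.

The expected score is affine in its second argument, because the
Lebesgue-Stieltjes measure of a mixture is the mixture of the measures
([lebesgue_stieltjes_mixture], [Rintegral_mixture]).  Three instances of
propriety then pin S(M, G) down:
- S(M, M) <= S(G, M), where both sides are expanded along M in the second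
  argument;
- S(F, F) <= S(M, F), which bounds from below the component of S(M, M) along F,
  the one about which nothing else is known;
- S(G, G) <= S(M, G).
The first two give (1 - l) (S(M, G) - S(G, G)) <= l (S(G, F) - S(F, F))
([expected_score_mixture_le]), and the third makes the left-hand side
nonnegative.  As the right-hand side tends to 0 with l, the score of M under G
is as close to that of G as desired ([expected_score_mixture_close]).

However small l is, M keeps the extremal features of F.  A max-functional takes
on M the larger of its values at F and G, which settles (b).  For (a), the tail
of M is at least l times that of F, so M inherits from F a tail heavier than
that of G and is not tail equivalent to G ([mixture_not_tail_equivalent]). *)

(** An integrable function of arbitrary sign reduces to the nonnegative case
through its positive and negative parts; integrability excludes the
indeterminate form when k is distributed over their difference. *)
Lemma integral_mscale d (T : measurableType d) (R : realType)
    (mu : {measure set T -> \bar R}) (D : set T) (k : {nonneg R})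
    (f : T -> \bar R) : measurable D -> mu.-integrable D f ->
  (\int[mscale k mu]_(x in D) f x = k%:num%:E * \int[mu]_(x in D) f x)%E.
Proof.
move=> mD intf; have mf := measurable_int _ intf.
rewrite [LHS]integralE ge0_integral_mscale//; last exact: measurable_funepos.
rewrite ge0_integral_mscale//; last exact: measurable_funeneg.
rewrite -muleBr//; first by rewrite -integralE.
exact: integrable_add_def.
Qed.

Lemma integrable_mscale d (T : measurableType d) (R : realType)
    (mu : {measure set T -> \bar R}) (D : set T) (k : {nonneg R})
    (f : T -> \bar R) : measurable D -> mu.-integrable D f ->
  (mscale k mu).-integrable D f.
Proof.
move=> mD /integrableP[mf intf]; apply/integrableP; split => //.
rewrite ge0_integral_mscale//; last exact: measurableT_comp.
by rewrite lte_mul_pinfty// lee_fin.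
Qed.

Lemma lebesgue_stieltjes_itvoc (R : realType) (F : cumulative R R) (a b : R) :
  a <= b ->
  lebesgue_stieltjes_measure F `]a, b]%classic = (F b - F a)%:E.
Proof.
move=> ab; rewrite /lebesgue_stieltjes_measure /measure_extension/=.
by rewrite measurable_mu_extE/= ?wlength_itv_bnd//; exact: is_ocitv.
Qed.

Section mixture_theory.
Context {R : realType} (l : {i01 R}) (F1 F0 : distribution_function R).

Let l_ge0 : 0 <= l%:num. Proof. by []. Qed.

Let onem_ge0 : 0 <= 1 - l%:num. Proof. by rewrite subr_ge0. Qed.

(** A Lebesgue-Stieltjes measure is determined by its values on half-open
intervals, the increments of its distribution function, and increments are
affine in the distribution function. *)
Lemma lebesgue_stieltjes_mixture A : measurable A ->
  lebesgue_stieltjes_measure (mixture l F1 F0) A =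
  measure_add (mscale (NngNum l_ge0) (lebesgue_stieltjes_measure F1))
              (mscale (NngNum onem_ge0) (lebesgue_stieltjes_measure F0)) A.
Proof.
apply: lebesgue_stieltjes_measure_unique => _ [[a b]] /= _ <-.
rewrite [RHS]measure_addE.
rewrite -[RHS]/(l%:num%:E * lebesgue_stieltjes_measure F1 `]a, b]%classic +
  (1 - l%:num)%:E * lebesgue_stieltjes_measure F0 `]a, b]%classic)%E.
have [ab|ba] := leP a b; last first.
  by rewrite set_itv_ge ?bnd_simp -?leNgt ?ltW// !measure0 !mule0 adde0.
rewrite !lebesgue_stieltjes_itvoc// -!EFinM -EFinD; congr (_%:E).
rewrite /= /mixture_fun; ring.
Qed.

Lemma Rintegral_mixture (f : R -> R) :
  (lebesgue_stieltjes_measure F1).-integrable [set: R] (EFin \o f) ->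
  (lebesgue_stieltjes_measure F0).-integrable [set: R] (EFin \o f) ->
  \int[lebesgue_stieltjes_measure (mixture l F1 F0)]_y f y =
  l%:num * \int[lebesgue_stieltjes_measure F1]_y f y +
  (1 - l%:num) * \int[lebesgue_stieltjes_measure F0]_y f y.
Proof.
move=> if1 if0; rewrite /Rintegral.
rewrite (eq_measure_integral (measure_add
    (mscale (NngNum l_ge0) (lebesgue_stieltjes_measure F1))
    (mscale (NngNum onem_ge0) (lebesgue_stieltjes_measure F0)))); last first.
  by move=> A mA _; exact: lebesgue_stieltjes_mixture.
have mf := measurable_int _ if1.
rewrite integral_measure_add//; [|exact: integrable_mscale..].
rewrite !integral_mscale//.
have fin1 := integrable_fin_num measurableT if1.
have fin0 := integrable_fin_num measurableT if0.
by rewrite fineD ?fineM// fin_numM.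
Qed.

End mixture_theory.

Section proper_scores.
Context {R : realType} (FF : set (distribution_function R))
  (S : distribution_function R -> R -> R).
Hypotheses (convFF : convex_family FF) (properS : proper_scoring_rule FF S).

Lemma expected_score_mixture (l : {i01 R}) H F1 F0 :
  FF H -> FF F1 -> FF F0 ->
  expected_score S H (mixture l F1 F0) =
  l%:num * expected_score S H F1 + (1 - l%:num) * expected_score S H F0.
Proof.
by move=> FH F1F F0F; apply: Rintegral_mixture;
  have [_] := properS.1 H FH; apply.
Qed.

(** Propriety is used twice: M := [mixture l F G] beats G under M, and F beats M
under F.  After the first inequality is expanded along M, the second one
replaces the uncontrolled term S(M, F) by the constant S(F, F). *)
Lemma expected_score_mixture_le (l : {i01 R}) F G : FF F -> FF G ->
  (1 - l%:num) * (expected_score S (mixture l F G) G - expected_score S G G) <=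
  l%:num * (expected_score S G F - expected_score S F F).
Proof.
move=> FFF FFG; have FFM := convFF l FFF FFG.
have pM := properS.2 _ _ FFM FFG; have pF := properS.2 _ _ FFF FFM.
rewrite !expected_score_mixture// in pM.
have l_ge0 : 0 <= l%:num by [].
have := ler_wpM2l l_ge0 pF; lra.
Qed.

Lemma expected_score_mixture_close F G : FF F -> FF G ->
  forall eps : R, 0 < eps -> exists2 l : {i01 R}, 0 < l%:num < 1 &
    `|expected_score S (mixture l F G) G - expected_score S G G| <= eps.
Proof.
move=> FFF FFG eps eps0.
pose C := expected_score S G F - expected_score S F F.
have C0 : 0 <= C by rewrite subr_ge0; exact: properS.2.
have d0 : 0 < eps + C + 1 by lra.
have l0 : 0 <= eps / (eps + C + 1) by rewrite divr_ge0// ltW.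
have l1 : eps / (eps + C + 1) <= 1 by rewrite ler_pdivrMr//; lra.
(* This weight solves l / (1 - l) = eps / (C + 1), so l C / (1 - l) <= eps; the
   1 keeps the weight below 1 when C = 0. *)
exists (Itv01 l0 l1) => /=.
  by rewrite divr_gt0//= ltr_pdivrMr//; lra.
have FFM := convFF (Itv01 l0 l1) FFF FFG.
rewrite ger0_norm ?subr_ge0; last exact: properS.2.
have := expected_score_mixture_le (Itv01 l0 l1) FFF FFG; rewrite /= -/C.
set a := expected_score _ _ G - _ => le_a.
have d_neq0 : eps + C + 1 != 0 by rewrite gt_eqF.
have : (C + 1) * a <= eps * C.
  have -> : (C + 1) * a =
      (eps + C + 1) * ((1 - eps / (eps + C + 1)) * a) by field.
  have -> : eps * C = (eps + C + 1) * (eps / (eps + C + 1) * C) by field.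
  by rewrite ler_pM2l.
move=> le_a'; rewrite -(@ler_pM2l _ (C + 1)); lra.
Qed.

End proper_scores.

Section tails.
Context {R : realType}.
Implicit Types F G : distribution_function R.

(** This keeps the denominators in tail ratios positive near the endpoint.  The
endpoint -oo is harmless, as F tends to 0 there. *)
Lemma near_lt1 F : \forall x \near left_filter (upper_endpoint F), F x < 1.
Proof.
have below x : (x%:E < upper_endpoint F)%E -> F x < 1.
  move=> /ereal_sup_gt[_ [y Fy1 <-]]; rewrite lte_fin => /ltW xy.
  by apply: le_lt_trans Fy1; exact: cumulative_is_nondecreasing.
case E : (upper_endpoint F) => [r| |] /=.
- near=> x; apply: below; rewrite E lte_fin; near: x; exact: nbhs_left_lt.
- by near=> x; apply: below; rewrite E ltry.
- apply: (cvgr_lt (0 : R)); [exact: cumulativeNy|exact: ltr01].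
Unshelve. all: by end_near. Qed.

Lemma distribution_function_le1 F x : F x <= 1.
Proof.
apply: (cvgr_to_ge (cumulativey F)).
near=> y; apply: cumulative_is_nondecreasing; near: y.
exact: nbhs_pinfty_ge.
Unshelve. all: by end_near. Qed.

Lemma tail_mixture (l : {i01 R}) F G x :
  tail (mixture l F G) x = l%:num * tail F x + (1 - l%:num) * tail G x.
Proof. by rewrite /tail /= /mixture_fun; ring. Qed.

(** If F reaches further than G, then so does the mixture.  If the endpoints
agree and tail M / tail G had a limit c, then multiplying by tail G / tail F,
which tends to 0, would give tail M / tail F --> c * 0 = 0, whereas this ratio
is at least l. *)
Lemma mixture_not_tail_equivalent (l : {i01 R}) F G :
  0 < l%:num < 1 -> heavier_tail F G ->
  ~ tail_equivalent (mixture l F G) G.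
Proof.
move=> /andP[l0 l1] heavy [eqM [c _ cvg_ratio]].
case: heavy => [|[eqF cvg_heavy]].
  rewrite ltNge => /negP; apply; rewrite -eqM.
  apply: ge_ereal_sup => _ [x Fx1 <-]; apply: ereal_sup_ubound.
  (* M x < 1 wherever F x < 1, since G x <= 1 and l > 0. *)
  exists x => //=; rewrite /mixture_fun.
  have := distribution_function_le1 G x; rewrite /= in Fx1; nra.
suff : l%:num <= 0 by rewrite leNgt l0.
have cvg0 : tail (mixture l F G) x / tail G x * (tail G x / tail F x)
    @[x --> left_filter (upper_endpoint F)] --> (0 : R).
  by rewrite -(mulr0 c); apply: cvgM => //; rewrite -eqF.
apply: (cvgr_to_ge cvg0).
near=> x.
have F1 : F x < 1 by near: x; exact: near_lt1.
have G1 : G x < 1 by near: x; rewrite -eqF; exact: near_lt1.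
have tF0 : 0 < tail F x by rewrite subr_gt0.
have tG0 : 0 < tail G x by rewrite subr_gt0.
rewrite mulrA divfK ?gt_eqF// tail_mixture ler_pdivlMr//.
by rewrite lerDl mulr_ge0 ?subr_ge0// ltW.
Unshelve. all: by end_near. Qed.

End tails.

Theorem theorem5p4 (R : realType) (FF : set (distribution_function R))
    (convFF : convex_family FF)
    (S : distribution_function R -> R -> R) (properS : proper_scoring_rule FF S)
    (G : distribution_function R) (FFG : FF G) :
  ((exists F, FF F /\ heavier_tail F G) ->
     forall eps : R, 0 < eps ->
       exists Feps, [/\ FF Feps, ~ tail_equivalent Feps G &
         `|expected_score S Feps G - expected_score S G G| <= eps])
  /\
  (forall T : distribution_function R -> R, max_functional FF T ->
     forall F, FF F -> T G < T F ->
     forall eps : R, 0 < eps ->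
       exists Feps, [/\ FF Feps, T Feps = T F, T G < T F &
         `|expected_score S Feps G - expected_score S G G| <= eps]).
Proof.
split=> [[F [FFF heavy]] eps eps0|T maxT F FFF TGF eps eps0].
  have [l l01 close] :=
    expected_score_mixture_close convFF properS FFF FFG eps0.
  exists (mixture l F G); split => //; first exact: convFF.
  exact: mixture_not_tail_equivalent.
have [l l01 close] := expected_score_mixture_close convFF properS FFF FFG eps0.
exists (mixture l F G); split => //; first exact: convFF.
by rewrite maxT// max_r// ltW.
Qed.
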